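(* Let $d=2$ and let $\mathcal{L}_0:\mathbb{R}^2\to\overline{\mathbb{R}}$ be defined by $\mathcal{L}_0(x)=\sup_{y\in\mathbb{R}^2}\big(\langle x,y\rangle-\max\{0,\ \|y\|_\infty-1,\ \|y\|-2\}\big)$. Then $$\mathcal{L}_0(x_1,x_2)=\begin{cases}+\infty&\text{if }x_1^2+x_2^2>1,\\ 1&\text{if }(x_1,x_2)\in\{(1,0),(0,1),(-1,0),(0,-1)\},\\ 2&\text{if }x_1^2+x_2^2=1\text{ and }(x_1,x_2)\notin\{(1,0),(0,1),(-1,0),(0,-1)\},\end{cases}$$ and, for any $(x_1,x_2)$ such that $x_1^2+x_2^2<1$, $$\mathcal{L}_0(x_1,x_2)=\begin{cases}|x_1|+|x_2|&\text{if }|x_1|+|x_2|\leq 1,\\[2mm] \dfrac{|x_1|+|x_2|-2+\sqrt2}{\sqrt2-1}&\text{if }(\sqrt2-1)|x_1|+|x_2|<1<|x_1|+|x_2|\\ &\text{and }|x_1|+(\sqrt2-1)|x_2|<1<|x_1|+|x_2|,\\[2mm] \dfrac{3-|x_2|}{2}+\dfrac{x_1^2}{2(1-|x_2|)}&\text{if }(\sqrt2-1)|x_1|+|x_2|\geq 1\text{ and }|x_2|>|x_1|,\\[3mm] \dfrac{3-|x_1|}{2}+\dfrac{x_2^2}{2(1-|x_1|)}&\text{if }|x_1|+(\sqrt2-1)|x_2|\geq 1\text{ and }|x_1|>|x_2|.\end{cases}$$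
   Context: $\mathbb{R}^2$ carries the usual scalar product $\langle\cdot,\cdot\rangle$ and Euclidean norm $\|\cdot\|$; $\|y\|_\infty=\max(|y_1|,|y_2|)$; $\overline{\mathbb{R}}=[-\infty,+\infty]$. The function $\mathcal{L}_0$ is the case $d=2$ of the Fenchel conjugate of $y\mapsto\sup_{l=0,1,\ldots,d}[\|y\|^{tn}_{(l)}-l]$ on $\mathbb{R}^d$, where $\|y\|^{tn}_{(l)}=\sup_{|K|\leq l}\|y_K\|$ is the top-$l$ norm ($y_K$ being $y$ with components outside $K\subset\{1,\ldots,d\}$ set to $0$) and $\|\cdot\|^{tn}_{(0)}=0$; for $d=2$ one has $\|\cdot\|^{tn}_{(1)}=\|\cdot\|_\infty$ and $\|\cdot\|^{tn}_{(2)}=\|\cdot\|$. *)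

(* Defs.v *)
From mathcomp Require Import all_boot all_order all_algebra.
From mathcomp Require Import all_classical all_reals ereal normedtype.

Set Implicit Arguments.
Unset Strict Implicit.
Unset Printing Implicit Defensive.

Import Order.TTheory GRing.Theory Num.Theory.
Import numFieldNormedType.Exports.

Local Open Scope classical_set_scope.
Local Open Scope ring_scope.

Definition dot (R : realType) (d : nat) (x y : 'rV[R]_d) : R :=
  \sum_(i < d) x 0 i * y 0 i.

(* Not the library norm of ['rV[R]_d], which is the sup norm. *)
Definition norm2 (R : realType) (d : nat) (y : 'rV[R]_d) : R :=
  Num.sqrt (dot y y).

Definition norminf (R : realType) (y : 'rV[R]_2) : R :=
  Num.max `|y 0 0| `|y 0 1|.

Definition L0 (R : realType) (x : 'rV[R]_2) : \bar R :=
  ereal_sup [set (dot x y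
                  - Num.max 0 (Num.max (norminf y - 1) (norm2 y - 2)))%:E
            | y in [set: 'rV[R]_2]].

(* Main.v *)
(* For t >= 0 the penalty max(0, |y|_oo - 1, |y| - 2) is at most t exactly when y
   lies in the box |y|_oo <= 1 + t and in the ball |y| <= 2 + t.  By sign symmetry,
   L0 x is therefore the value of the convex program: maximize |x1| u + |x2| v - t
   over nonnegative u, v, t in this region.  If |x1| + |x2| <= 1 then t = 0 is
   optimal.  If |x1| + |x2| > 1 and |x| < 1, then writing
   (|x1|, |x2|) = l1 e1 + l2 e2 + l3 w, with w a unit vector and nonnegative weights
   of sum 1, bounds the value by 1 + l3.  This bound is attained at the corner
   u = v = 1 + sqrt 2 when w is diagonal, and where the ray along w meets both an
   edge of the box and the circle when l1 or l2 vanishes.  On and outside the unit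
   circle one looks at y = r x for large r. *)
Require Import Defs.
From mathcomp Require Import all_boot all_order all_algebra.
From mathcomp Require Import all_classical all_reals ereal normedtype.
From mathcomp Require Import ring lra.

Set Implicit Arguments.
Unset Strict Implicit.
Unset Printing Implicit Defensive.

Import Order.TTheory GRing.Theory Num.Theory.
Import numFieldNormedType.Exports.

Local Open Scope classical_set_scope.
Local Open Scope ring_scope.

(** * Reduction of the conjugate to a convex program *)

Definition feasible (R : realType) (u v t : R) : Prop :=
  [/\ 0 <= u <= 1 + t, 0 <= v <= 1 + t, 0 <= t
    & u ^+ 2 + v ^+ 2 <= (2 + t) ^+ 2].

Definition program_value (R : realType) (a b m : R) : Prop :=
  (forall u v t, feasible u v t -> a * u + b * v - t <= m) /\
  (exists u v t, feasible u v t /\ a * u + b * v - t = m).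

Lemma dot2 (R : realType) (x y : 'rV[R]_2) :
  dot x y = x 0 0 * y 0 0 + x 0 1 * y 0 1.
Proof.
rewrite /dot big_ord_recl big_ord1.
by have -> : lift ord0 ord0 = 1 :> 'I_2 by apply/val_inj.
Qed.

Lemma norm2_le (R : realType) (y : 'rV[R]_2) (r : R) : 0 <= r ->
  (norm2 y <= r) = (y 0 0 ^+ 2 + y 0 1 ^+ 2 <= r ^+ 2).
Proof.
move=> r0; rewrite /norm2 dot2 -!expr2.
have s0 : 0 <= y 0 0 ^+ 2 + y 0 1 ^+ 2 by rewrite addr_ge0 ?sqr_ge0.
by rewrite -{2}(sqr_sqrtr s0) ler_sqr ?nnegrE ?sqrtr_ge0.
Qed.

Lemma feasible_penalty (R : realType) (y : 'rV[R]_2) :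
  feasible `|y 0 0| `|y 0 1|
    (Num.max 0 (Num.max (norminf y - 1) (norm2 y - 2))).
Proof.
set t := Num.max _ _.
have : t <= t by [].
rewrite {1}/t !ge_max !lerBlDl /norminf ge_max => /and3P[t0 /andP[y0 y1]].
rewrite norm2_le ?addr_ge0 // => y2.
by split; rewrite ?normr_ge0 // !real_normK ?num_real.
Qed.

Lemma L0_le (R : realType) (x : 'rV[R]_2) (m : R) :
  (forall u v t, feasible u v t -> `|x 0 0| * u + `|x 0 1| * v - t <= m) ->
  (L0 x <= m%:E)%E.
Proof.
move=> H; apply: ge_ereal_sup => _ [y _ <-]; rewrite lee_fin.
apply: le_trans (H _ _ _ (feasible_penalty y)).
by rewrite lerD2r dot2 -!normrM lerD ?ler_norm.
Qed.

Lemma L0_ge (R : realType) (x : 'rV[R]_2) (u v t : R) : feasible u v t ->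
  ((`|x 0 0| * u + `|x 0 1| * v - t)%:E <= L0 x)%E.
Proof.
move=> [/andP[u0 ut] /andP[v0 vt] t0 uvt].
have sg_le (z w : R) : 0 <= w -> `|Num.sg z * w| <= w.
  move=> w0; rewrite normrM (ger0_norm w0) normr_sg.
  by case: (z != 0); rewrite ?mul1r ?mul0r.
(* With the signs of [x], [dot x y] becomes [|x1| u + |x2| v]. Where a coordinate of [x] is 0, so is
   [Num.sg]; [y] then shrinks there, which keeps the constraints. *)
pose y : 'rV[R]_2 :=
  \row_j (if j == 0 then Num.sg (x 0 0) * u else Num.sg (x 0 1) * v).
have y0 : y 0 0 = Num.sg (x 0 0) * u by rewrite mxE.
have y1 : y 0 1 = Num.sg (x 0 1) * v by rewrite mxE.
apply: le_trans (ereal_sup_ubound _); last by exists y.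
rewrite lee_fin dot2 y0 y1 !mulrA ![_ * Num.sg _]mulrC -!normrEsg lerD2l lerN2.
have t1 : 0 <= 2 + t by rewrite addr_ge0.
rewrite !ge_max t0 !lerBlDl /norminf ge_max norm2_le // y0 y1.
rewrite (le_trans (sg_le _ _ u0) ut) (le_trans (sg_le _ _ v0) vt) /=.
by apply: le_trans uvt; rewrite lerD // -real_normK ?num_real // ler_sqr ?nnegrE
  ?normr_ge0 // sg_le.
Qed.

Lemma L0_program_value (R : realType) (x : 'rV[R]_2) (m : R) :
  program_value `|x 0 0| `|x 0 1| m -> L0 x = m%:E.
Proof.
move=> [le_m [u [v [t [uvt mE]]]]].
apply: le_anti; rewrite L0_le //=.
by rewrite -mE L0_ge.
Qed.

Lemma program_valueC (R : realType) (a b m : R) :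
  program_value a b m -> program_value b a m.
Proof.
have swap (u v t : R) : feasible u v t -> feasible v u t.
  by case=> ? ? ? ?; split; rewrite // addrC.
move=> [le_m [u [v [t [uvt mE]]]]]; split=> [u' v' t' /swap uvt'|].
  by rewrite [b * _ + _]addrC; apply: le_m.
by exists v, u, t; split; [apply: swap | rewrite [b * _ + _]addrC mE].
Qed.

(** * Values of the program in the open unit disc *)

Lemma cauchy_schwarz2 (R : realType) (p q u v l r : R) :
  0 <= l -> 0 <= r -> p ^+ 2 + q ^+ 2 <= l ^+ 2 ->
  u ^+ 2 + v ^+ 2 <= r ^+ 2 -> p * u + q * v <= l * r.
Proof.
move=> l0 r0 pq uv; apply: le_trans (ler_norm _) _.
rewrite -ler_sqr ?nnegrE ?mulr_ge0 // real_normK ?num_real // exprMn.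
have H : (p ^+ 2 + q ^+ 2) * (u ^+ 2 + v ^+ 2) <= l ^+ 2 * r ^+ 2.
  by rewrite ler_pM ?addr_ge0 ?sqr_ge0.
(* Lagrange's identity: this square is the gap between the product of the two sums of squares and
   [(p u + q v) ^ 2]. *)
have := sqr_ge0 (p * v - q * u); nra.
Qed.

(** The box alone gives [(a + b) (1 + t) - t <= a + b]; its corner [(1, 1)] at [t = 0] is also in
    the ball. *)
Lemma program_value_l1 (R : realType) (a b : R) : 0 <= a -> 0 <= b ->
  a + b <= 1 -> program_value a b (a + b).
Proof.
move=> a0 b0 ab; split=> [u v t [/andP[u0 ut] /andP[v0 vt] t0 _]|]; first by nra.
by exists 1, 1, 0; split; [split; lra | ring].
Qed.

Lemma program_value_corner (R : realType) (a b : R) (c := Num.sqrt 2 - 1) :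
  c * a + b <= 1 -> a + c * b <= 1 -> 1 <= a + b ->
  program_value a b ((a + b - 2 + Num.sqrt 2) / c).
Proof.
move=> ab ba ab1.
have s0 : 0 <= Num.sqrt 2 :> R by rewrite sqrtr_ge0.
have ss : Num.sqrt 2 * Num.sqrt 2 = 2 :> R by rewrite -expr2 sqr_sqrtr.
have cE : Num.sqrt 2 = c + 1 by rewrite /c; ring.
have c0 : 0 < c by rewrite /c; nra.
have cc : c * c = 1 - 2 * c by rewrite /c; lra.
move: c0 cc ab ba; rewrite cE; clearbody c => c0 cc ab ba.
(* The weights for [w = ((c + 1) / 2, (c + 1) / 2)] have sum 1 exactly when [l3 c = a + b - 1], and
   [c + 2] is the inverse of [c]. The first two hypotheses then say that [l1] and [l2] are
   nonnegative. *)
pose l3 := (a + b - 1) * (c + 2).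
have ci : c^-1 = c + 2.
  by apply: (mulfI (lt0r_neq0 c0)); rewrite mulfV ?lt0r_neq0 //; lra.
have -> : (a + b - 2 + (c + 1)) / c = 1 + l3.
  by rewrite ci /l3; lra.
have acc : a * (c * c) = a * (1 - 2 * c) by rewrite cc.
have bcc : b * (c * c) = b * (1 - 2 * c) by rewrite cc.
pose l1 := a - l3 * (c + 1) / 2; pose l2 := b - l3 * (c + 1) / 2.
have l10 : 0 <= l1.
  have -> : l1 = (1 - (c * a + b)) * (c + 3) / 2 by rewrite /l1 /l3; lra.
  by apply: divr_ge0 => //; apply: mulr_ge0; lra.
have l20 : 0 <= l2.
  have -> : l2 = (1 - (a + c * b)) * (c + 3) / 2 by rewrite /l2 /l3; lra.
  by apply: divr_ge0 => //; apply: mulr_ge0; lra.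
have l30 : 0 <= l3 by rewrite /l3 mulr_ge0; lra.
have l123 : l1 + l2 + l3 = 1 by rewrite /l1 /l2 /l3; lra.
split=> [u v t [/andP[u0 ut] /andP[v0 vt] t0 uv]|]; last first.
  (* At [t = sqrt 2] the corner of the box lies on the circle. *)
  exists (c + 2), (c + 2), (c + 1); split; last by rewrite /l3; lra.
  by split; lra.
have diag : (c + 1) / 2 * u + (c + 1) / 2 * v <= 1 * (2 + t).
  by apply: cauchy_schwarz2 uv; lra.
have -> : a * u + b * v - t = l1 * u + l2 * v
    + l3 * ((c + 1) / 2 * u + (c + 1) / 2 * v) - t by rewrite /l1 /l2; lra.
have h1 : l1 * u <= l1 * (1 + t) by rewrite ler_wpM2l.
have h2 : l2 * v <= l2 * (1 + t) by rewrite ler_wpM2l.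
have h3 := ler_wpM2l l30 diag; nra.
Qed.

(** Only [e2] and [w] carry weight. The bound on [a ^ 2 + b ^ 2] makes the weight of [e2]
    nonnegative; [1 <= c a + b] puts the maximizer inside the box. *)
Lemma program_value_edge (R : realType) (a b : R) (c := Num.sqrt 2 - 1) :
  0 <= a -> a ^+ 2 + b ^+ 2 <= 1 -> b < 1 -> 1 <= c * a + b ->
  program_value a b ((3 - b) / 2 + a ^+ 2 / (2 * (1 - b))).
Proof.
move=> a0 ab1 b1 ab.
have s0 : 0 <= Num.sqrt 2 :> R by rewrite sqrtr_ge0.
have ss : Num.sqrt 2 * Num.sqrt 2 = 2 :> R by rewrite -expr2 sqr_sqrtr.
have c0 : 0 < c by rewrite /c; nra.
have cc : c * c = 1 - 2 * c by rewrite /c; lra.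
clearbody c; pose s := 1 - b; pose k := a / s.
have s_gt0 : 0 < s by rewrite /s; lra.
have aE : a = k * s by rewrite /k divfK ?lt0r_neq0.
have bE : b = 1 - s by rewrite /s; ring.
have k0 : 0 <= k by rewrite /k divr_ge0 // ltW.
have kc : 1 <= c * k by rewrite -(ler_pM2r s_gt0) mul1r -mulrA -aE; lra.
have kc2 : c + 2 <= k by rewrite -(ler_pM2l c0); lra.
(* [(a, b) = (1 - l) e2 + (a, b - 1 + l)], where [l] solves
   [l ^ 2 = a ^ 2 + (b - 1 + l) ^ 2]. *)
pose l := s * (1 + k ^+ 2) / 2.
have -> : (3 - b) / 2 + a ^+ 2 / (2 * (1 - b)) = 1 + l.
  by rewrite -/s aE {1}bE /l; field; rewrite lt0r_neq0.
have l0 : 0 <= l by have := sqr_ge0 k; rewrite /l; nra.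
have l1 : l <= 1.
  rewrite -(ler_pM2l s_gt0) /l.
  by move: ab1; rewrite aE bE; lra.
split=> [u v t [/andP[u0 ut] /andP[v0 vt] t0 uv]|].
  have cs : a * u + (b - 1 + l) * v <= l * (2 + t).
    apply: cauchy_schwarz2 uv => //; first lra.
    by rewrite aE bE /l le_eqVlt; apply/orP; left; apply/eqP; field.
  have h : (1 - l) * v <= (1 - l) * (1 + t) by rewrite ler_wpM2l ?subr_ge0.
  by nra.
(* This is [u <= 1 + t] at the witness below; the roots of [X ^ 2 - 2 X - 1] are [c + 2] and
   [- c]. *)
have kk : 2 * k + 1 <= k ^+ 2.
  have : 0 <= (k - (c + 2)) * (k + c) by rewrite mulr_ge0; lra.
  lra.
(* Solves [v = 1 + t] and [u ^ 2 + v ^ 2 = (2 + t) ^ 2] with [(u, v)] proportional to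
   [(a, b - 1 + l)]. *)
exists k, ((k ^+ 2 - 1) / 2), ((k ^+ 2 - 3) / 2); split; last first.
  by rewrite aE bE /l; field.
by split; lra.
Qed.

(** * The unit circle and its exterior *)

Lemma program_value_circle (R : realType) (a b : R) :
  0 <= a < 1 -> 0 <= b < 1 -> a ^+ 2 + b ^+ 2 = 1 -> program_value a b 2.
Proof.
move=> /andP[a0 a1] /andP[b0 b1] ab; split=> [u v t [_ _ t0 uv]|].
  have := @cauchy_schwarz2 R a b u v 1 (2 + t).
  by rewrite ab expr1n => /(_ ler01 _ _ uv) H; have := H _ _; lra.
have ai : (1 - a) * (1 - a)^-1 = 1 by rewrite mulfV //; lra.
have bi : (1 - b) * (1 - b)^-1 = 1 by rewrite mulfV //; lra.
have p0 : 0 < (1 - a)^-1 by rewrite invr_gt0 subr_gt0.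
have q0 : 0 < (1 - b)^-1 by rewrite invr_gt0 subr_gt0.
move: (1 - a)^-1 (1 - b)^-1 ai bi p0 q0 => p q ai bi p0 q0.
(* The point [r (a, b)] with [t = r - 2] lies on the circle, and in the box once [r (1 - a)] and
   [r (1 - b)] are at least 1. *)
pose r := 2 + p + q.
have ra : 1 <= r * (1 - a).
  by have : 0 <= (2 + q) * (1 - a); [rewrite mulr_ge0 |]; rewrite /r; lra.
have rb : 1 <= r * (1 - b).
  by have : 0 <= (2 + p) * (1 - b); [rewrite mulr_ge0 |]; rewrite /r; lra.
have r2 : 2 <= r by rewrite /r; lra.
have r0 : 0 <= r by lra.
exists (r * a), (r * b), (r - 2); split; last first.
  have -> : a * (r * a) + b * (r * b) = r * (a ^+ 2 + b ^+ 2) by ring.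
  by rewrite ab; ring.
split; rewrite ?mulr_ge0 //=; try lra.
by rewrite !exprMn -mulrDr ab mulr1 subrKC.
Qed.

Lemma program_value_axis (R : realType) : program_value (1 : R) 0 1.
Proof.
split=> [u v t [/andP[u0 ut] _ _ _]|]; first lra.
by exists 1, 0, 0; split; [split; lra | ring].
Qed.

Lemma L0_outside (R : realType) (x : 'rV[R]_2) :
  1 < x 0 0 ^+ 2 + x 0 1 ^+ 2 -> L0 x = +oo%E.
Proof.
set a := `|x 0 0|; set b := `|x 0 1|.
have -> : x 0 0 ^+ 2 = a ^+ 2 by rewrite real_normK ?num_real.
have -> : x 0 1 ^+ 2 = b ^+ 2 by rewrite real_normK ?num_real.
move=> ab; have a0 : 0 <= a := normr_ge0 _.
have b0 : 0 <= b := normr_ge0 _.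
pose s := Num.sqrt (a ^+ 2 + b ^+ 2).
have sE : s ^+ 2 = a ^+ 2 + b ^+ 2.
  by rewrite sqr_sqrtr // addr_ge0 ?sqr_ge0.
have s0 : 0 <= s by rewrite sqrtr_ge0.
have s1 : 1 < s by rewrite -ltr_sqr ?nnegrE // sE expr1n.
have as_ : a <= s by rewrite -ler_sqr ?nnegrE // sE lerDl sqr_ge0.
have bs : b <= s by rewrite -ler_sqr ?nnegrE // sE lerDr sqr_ge0.
(* At [r (a, b)] with [t = r s] the objective is [r (s - 1) s], here [A s >= A]. *)
apply/eqyP => A A0; pose r := A / (s - 1).
have r0 : 0 <= r by rewrite divr_ge0 // ?subr_ge0 ltW.
have rA : r * (s - 1) = A by rewrite divfK // subr_eq0 gt_eqF.
clearbody r.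
have uvt : feasible (r * a) (r * b) (r * s).
  have ra := ler_wpM2l r0 as_; have rb := ler_wpM2l r0 bs.
  split; rewrite ?mulr_ge0 //=; try lra.
  rewrite !exprMn -mulrDr -sE -exprMn ler_sqr ?nnegrE ?addr_ge0 ?mulr_ge0 //.
  by rewrite lerDr.
apply: le_trans (L0_ge x uvt); rewrite lee_fin -/a -/b.
have -> : a * (r * a) + b * (r * b) - r * s = r * (s - 1) * s.
  by rewrite mulrBr mulrBl mulr1 -mulrA -expr2 sE; ring.
by rewrite rA ler_peMr // ltW.
Qed.

Theorem proposition4p3 (R : realType) (x : 'rV[R]_2) :
  let x1 := x 0 0 in
  let x2 := x 0 1 in
  let axis_points : seq (R * R) := [:: (1, 0); (0, 1); (-1, 0); (0, -1)] in
  let c : R := Num.sqrt 2 - 1 in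
  let case1 := `|x1| + `|x2| <= 1 in
  let case2 := (c * `|x1| + `|x2| < 1 < `|x1| + `|x2|)
            && (`|x1| + c * `|x2| < 1 < `|x1| + `|x2|) in
  let case3 := (1 <= c * `|x1| + `|x2|) && (`|x1| < `|x2|) in
  let case4 := (1 <= `|x1| + c * `|x2|) && (`|x2| < `|x1|) in
  [/\ 1 < x1 ^+ 2 + x2 ^+ 2 -> L0 x = +oo%E,
      (x1, x2) \in axis_points -> L0 x = 1%:E,
      x1 ^+ 2 + x2 ^+ 2 = 1 -> (x1, x2) \notin axis_points -> L0 x = 2%:E
    & x1 ^+ 2 + x2 ^+ 2 < 1 ->
      [/\ case1 -> L0 x = (`|x1| + `|x2|)%:E,
          case2 -> L0 x = ((`|x1| + `|x2| - 2 + Num.sqrt 2)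
                           / (Num.sqrt 2 - 1))%:E,
          case3 -> L0 x = ((3 - `|x2|) / 2
                           + x1 ^+ 2 / (2 * (1 - `|x2|)))%:E,
          case4 -> L0 x = ((3 - `|x1|) / 2
                           + x2 ^+ 2 / (2 * (1 - `|x1|)))%:E
        & [|| case1, case2, case3 | case4]]].
Proof.
move=> x1 x2 axis_points c case1 case2 case3 case4.
have a0 := normr_ge0 x1; have b0 := normr_ge0 x2.
have aE : x1 ^+ 2 = `|x1| ^+ 2 by rewrite real_normK ?num_real.
have bE : x2 ^+ 2 = `|x2| ^+ 2 by rewrite real_normK ?num_real.
split; first exact: L0_outside.
- rewrite !inE => H; apply: L0_program_value; rewrite -/x1 -/x2.
  by case/or4P: H => /eqP[-> ->]; rewrite ?normrN ?normr1 ?normr0;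
    first [exact: program_value_axis
          | exact/program_valueC/program_value_axis].
- move=> x12 naxis; apply: L0_program_value; rewrite -/x1 -/x2.
  have lt1 (y z : R) : y ^+ 2 + z ^+ 2 = 1 ->
      ((y == 1) || (y == -1)) && (z == 0) = false -> `|y| < 1.
    move=> yz; apply: contraFT; rewrite -leNgt => y1.
    have z0 : z = 0.
      apply/eqP; rewrite -sqrf_eq0 eq_le sqr_ge0 andbT.
      by move: yz; rewrite -[y ^+ 2]real_normK ?num_real //; nra.
    move: yz; rewrite z0 eqxx andbT expr0n addr0 => /eqP.
    by rewrite sqrf_eq1.
  move: naxis; rewrite !inE !xpair_eqE => /norP[n1 /norP[n2 /norP[n3 n4]]].
  apply: program_value_circle; last by rewrite -aE -bE.
    rewrite a0 (lt1 x1 x2) // andb_orl.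
    by rewrite (negbTE n1) (negbTE n3).
  rewrite b0 (lt1 x2 x1) 1?addrC // andb_orl ![_ && (x1 == 0)]andbC.
  by rewrite (negbTE n2) (negbTE n4).
move=> x12; have ab1 : `|x1| ^+ 2 + `|x2| ^+ 2 <= 1 by rewrite -aE -bE ltW.
have a1 : `|x1| < 1 by nra.
have b1 : `|x2| < 1 by nra.
split.
- by move=> ab; apply: L0_program_value; apply: program_value_l1.
- move=> /andP[/andP[ab1' ab] /andP[ba _]]; apply: L0_program_value.
  by apply: program_value_corner; apply: ltW.
- by move=> /andP[ab _]; apply: L0_program_value; rewrite aE;
    apply: program_value_edge.
- move=> /andP[ab _]; apply: L0_program_value; apply: program_valueC; rewrite bE.
  by apply: program_value_edge; rewrite // addrC.
(* The four cases cover the open disc: as [c < 1], off the diagonal the larger coordinate decides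
   between the second case and the third or fourth. *)
have c1 : c < 1.
  by rewrite ltrBlDr -(ltr_pXn2r (n := 2)) ?nnegrE ?sqrtr_ge0 // sqr_sqrtr //;
    lra.
apply/orP; case: (leP (`|x1| + `|x2|) 1) => ab; [by left | right].
rewrite /case2 /case3 /case4 ab !andbT.
case: (ltgtP `|x1| `|x2|) => [lt12|lt21|eq12]; rewrite ?andbT ?andbF ?orbF /=.
- by rewrite orbC; case: leP => //= h; nra.
- by rewrite orbC; case: (leP 1 (`|x1| + c * `|x2|)) => //= h;
    rewrite andbT; nra.
have ss : Num.sqrt 2 * Num.sqrt 2 = 2 :> R by rewrite -expr2 sqr_sqrtr.
have s0 : 0 <= Num.sqrt 2 :> R by rewrite sqrtr_ge0.
move: x12; rewrite aE bE /c -eq12 => x12.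
(* On the diagonal only the second case remains, and it follows from [2 x1 ^ 2 < 1]. *)
have sx : Num.sqrt 2 * `|x1| < 1.
  by rewrite -ltr_sqr ?nnegrE ?mulr_ge0 // expr1n exprMn expr2 ss; lra.
by apply/andP; split; lra.
Qed.
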